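(* Let $\Gamma$ be a nonabelian free group of (finite) rank $m$ with finite generating set $X$. Then $n^{1/3}\preceq \mathrm{F}_{\Gamma,X}(n)$.
   Context: $\|\cdot\|_X$ denotes word length with respect to $X$. $\mathrm{F}_{\Gamma,X}(n)$ is the smallest positive integer $N$ such that for every nontrivial $\gamma\in\Gamma$ with $\|\gamma\|_X\le n$ there is a normal subgroup of $\Gamma$ of finite index at most $N$ not containing $\gamma$. For functions $f_1,f_2$ on the positive integers with values in $[0,\infty]$, $f_1\preceq f_2$ means that there is a constant $C$ (a positive integer) such that $f_1(n)\le C f_2(Cn)$ for all $n\geq 1$. *)

(* Defs.v *)
From mathcomp Require Import all_boot all_order all_algebra.
From mathcomp Require Import all_classical all_reals all_analysis.

Set Implicit Arguments.
Unset Strict Implicit.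
Unset Printing Implicit Defensive.

Import Order.TTheory GRing.Theory Num.Theory.

Local Open Scope classical_set_scope.
Local Open Scope group_scope.

(* Groups are [groupType]s of [boot/monoid.v], which need not be finite;
   subsets of them are classical sets. *)

Definition subgroup (G : groupType) (H : set G) : Prop := group_closed [in H].

Definition normal_subgroup (G : groupType) (H : set G) : Prop :=
  subgroup H /\ forall h g : G, H h -> H (h ^ g).

Definition left_cosets (G : groupType) (H : set G) : set (set G) :=
  [set [set g * h | h in H] | g in [set: G]].

Definition index_le (G : groupType) (H : set G) (N : nat) : Prop :=
  (left_cosets H #<= `I_N)%card.

Definition generates (G : groupType) (X : set G) : Prop :=
  forall H : set G, subgroup H -> X `<=` H -> H = [set: G].

(* The universal property of a free group on the family [e]; a multiplicative
   map between groups automatically preserves 1 and inverses. *)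
Definition free_basis (G : groupType) (m : nat) (e : 'I_m -> G) : Prop :=
  forall (K : groupType) (f : 'I_m -> K),
    (exists phi : {multiplicative G -> K}, forall i, phi (e i) = f i) /\
    (forall phi psi : {multiplicative G -> K},
       (forall i, phi (e i) = f i) -> (forall i, psi (e i) = f i) ->
       phi =1 psi).

Definition free_of_rank (G : groupType) (m : nat) : Prop :=
  exists e : 'I_m -> G, free_basis e.

Definition nonabelian (G : groupType) : Prop :=
  ~ (forall x y : G, x * y = y * x).

(* The smallest natural number satisfying P, +oo if there is none. *)
Definition least (R : realType) (P : set nat) : \bar R :=
  if pselect (exists k, `[< P k >]) is left exP then (ex_minn exP)%:R%:E
  else +oo%E.

Lemma least_le (R : realType) (P : set nat) (n : nat) :
  (least R P <= n%:R%:E)%E <-> exists2 k : nat, P k & (k <= n)%N.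
Proof.
rewrite /least; case: pselect => [exP|nexP]; last first.
  by split=> [|[k Pk _]]; [rewrite leye_eq | case: nexP; exists k; exact/asboolP].
case: ex_minnP => k /asboolP Pk kmin; rewrite lee_fin ler_nat.
split=> [kn|[l Pl ln]]; first by exists k.
by apply: leq_trans ln; exact/kmin/asboolP.
Qed.

(* Length of a shortest word in X and its inverses that represents g, +oo if
   g is not in the subgroup generated by X. *)
Definition word_length (R : realType) (G : groupType) (X : set G) (g : G) :
    \bar R :=
  least R [set k | exists w : seq G,
    [/\ size w = k, forall x, x \in w -> X x \/ X x^-1
      & \prod_(x <- w) x = g]].

Definition rf_growth (R : realType) (G : groupType) (X : set G) (n : nat) :
    \bar R :=
  least R [set N | (0 < N)%N /\
    forall g : G, g <> 1 -> (word_length R X g <= n%:R%:E)%E ->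
      exists H : set G, [/\ normal_subgroup H, index_le H N & ~ H g]].

(* Functions on the positive integers are represented by functions on nat whose
   value at 0 is irrelevant. *)
Definition asymp_le (R : realType) (f1 f2 : nat -> \bar R) : Prop :=
  exists2 C : nat, (0 < C)%N &
    forall n : nat, (0 < n)%N -> (f1 n <= C%:R%:E * f2 (C * n)%N)%E.

(* Main.v *)
(* In a finite quotient of order at most N some power a^j with 0 < j <= N of an
   element a dies, so a word that lies in the normal closure of each of
   a, a^2, ..., a^N dies in all these quotients.  A balanced tree of commutators
   with these powers as leaves is such a word, of length O(N^3).  To see that it is
   nontrivial, map the free group to GL_2 of a finite field of characteristic 2,
   sending one basis element a to diag(t, 1) with t of order larger than N and
   another one to a suitable b.  Conjugating one argument by 1, a or b keeps the two
   arguments of each commutator from commuting, and in characteristic 2 a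
   nontrivial commutator in GL_2 is not scalar, so the construction goes on. *)

From HB Require Import structures.
Require Import Defs.
From mathcomp Require Import all_boot all_order all_algebra.
From mathcomp Require Import all_fingroup all_solvable all_field.
From mathcomp Require Import all_classical all_reals all_analysis.
From mathcomp Require Import ring zify.

Set Implicit Arguments.
Unset Strict Implicit.
Unset Printing Implicit Defensive.

Import Order.TTheory GRing.Theory Num.Theory.

Local Open Scope classical_set_scope.
Local Open Scope ring_scope.
Local Open Scope group_scope.

Section Words.
Variables (G : groupType) (X : set G).

Definition word_le (k : nat) (g : G) : Prop :=
  exists w : seq G, [/\ (size w <= k)%N, forall x, x \in w -> X x \/ X x^-1
    & \prod_(x <- w) x = g].

Lemma word_length_le (R : realType) (g : G) (n : nat) :
  (word_length R X g <= n%:R%:E)%E <-> word_le n g.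
Proof.
rewrite /word_length least_le; split=> [[k [w [<- wX wg]] kn]|[w [wn wX wg]]].
  by exists w.
by exists (size w) => //; exists w.
Qed.

Lemma word_le1 k : word_le k 1.
Proof. by exists [::]; split=> //; rewrite big_nil. Qed.

Lemma word_le_leq k l g : (k <= l)%N -> word_le k g -> word_le l g.
Proof. by move=> kl [w [wk wX wg]]; exists w; split=> //; apply: leq_trans kl. Qed.

Lemma word_leM k l g h : word_le k g -> word_le l h -> word_le (k + l) (g * h).
Proof.
move=> [v [vk vX <-]] [w [wl wX <-]]; exists (v ++ w); split.
- by rewrite size_cat leq_add.
- by move=> x; rewrite mem_cat => /orP[/vX|/wX].
- by rewrite big_cat.
Qed.

Lemma word_leV k g : word_le k g -> word_le k g^-1.
Proof.
move=> [w [wk wX <-]]; exists (rev [seq x^-1 | x <- w]); split.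
- by rewrite size_rev size_map.
- move=> x; rewrite mem_rev => /mapP[y /wX yX ->].
  by rewrite invgK; case: yX; [right|left].
- elim: w {wk wX} => [|x w IH]; first by rewrite !big_nil invg1.
  by rewrite /= rev_cons -cats1 big_cat /= !big_cons big_nil mulg1 IH invgM.
Qed.

Lemma word_leX k g j : word_le k g -> word_le (j * k) (g ^+ j).
Proof.
move=> gk; elim: j => [|j IH]; first by rewrite expg0; apply: word_le1.
by rewrite expgS mulSn; apply: word_leM.
Qed.

Lemma word_leJ k l g h :
  word_le k g -> word_le l h -> word_le (k + l.*2) (g ^ h).
Proof.
move=> gk hl; rewrite conjgE.
apply: (@word_le_leq (l + (k + l))); first by rewrite addnCA addnn.
by apply: word_leM; [exact: word_leV | exact: word_leM].
Qed.

Lemma word_leR k l g h :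
  word_le k g -> word_le l h -> word_le (k + l).*2 [~ g, h].
Proof.
move=> gk hl; rewrite commgEl.
apply: (@word_le_leq (k + (k + l.*2))); first by rewrite addnA addnn doubleD.
by apply: word_leM; [exact: word_leV | exact: word_leJ].
Qed.

Lemma generates_word (g : G) : generates X -> exists k, word_le k g.
Proof.
move=> genX; suff E : [set g | exists k, word_le k g] = [set: G].
  by rewrite -[exists k, _]/([set g | exists k, word_le k g] g) E.
have in1 : [set g | exists k, word_le k g] 1 by exists 0%N; apply: word_le1.
apply: genX.
  split; first by rewrite inE.
  move=> u v; rewrite !inE => -[k uk] [l vl].
  by exists (k + l)%N; apply: word_leM => //; apply: word_leV.
move=> x Xx; exists 1%N, [:: x]; split=> //.
  by move=> y; rewrite inE => /eqP ->; left.
by rewrite big_cons big_nil mulg1.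
Qed.

End Words.

Section NormalSubgroups.
Variables (G : groupType) (H : set G).
Hypothesis nH : normal_subgroup H.

Lemma normal_subgroup1 : H 1.
Proof. by case: nH => -[]; rewrite inE. Qed.

Lemma normal_subgroupF u v : H u -> H v -> H (u * v^-1).
Proof.
by case: nH => -[_ HF] _ Hu Hv; rewrite -in_setE; apply: HF; rewrite inE.
Qed.

Lemma normal_subgroupV u : H u -> H u^-1.
Proof.
move=> Hu; rewrite -div1g; apply: normal_subgroupF => //.
exact: normal_subgroup1.
Qed.

Lemma normal_subgroupM u v : H u -> H v -> H (u * v).
Proof.
by move=> Hu /normal_subgroupV Hv; rewrite -(invgK v); apply: normal_subgroupF.
Qed.

Lemma normal_subgroupJ u v : H u -> H (u ^ v).
Proof. by case: nH => _; apply. Qed.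

Lemma normal_subgroupRl u v : H u -> H [~ u, v].
Proof.
move=> Hu; rewrite commgEl; apply: normal_subgroupM.
  exact: normal_subgroupV.
exact: normal_subgroupJ.
Qed.

Lemma normal_subgroupRr u v : H v -> H [~ u, v].
Proof. by move=> /(@normal_subgroupRl _ u)/normal_subgroupV; rewrite invgR. Qed.

Lemma index_le_expg (N : nat) (x : G) :
  index_le H N -> exists2 j : nat, (0 < j <= N)%N & H (x ^+ j).
Proof.
move=> HN; apply: contrapT => noj.
have xH (i j : nat) : (i < j < N.+1)%N ->
    [set x ^+ i * h | h in H] = [set x ^+ j * h | h in H] -> False.
  move=> /andP[ij jN] eqH; apply: noj; exists (j - i)%N.
    by rewrite subn_gt0 ij (leq_trans (leq_subr _ _)).
  have: [set x ^+ j * h | h in H] (x ^+ j).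
    by exists 1; [exact: normal_subgroup1 | rewrite mulg1].
  rewrite -eqH => -[h Hh /esym]; rewrite -(subnKC (ltnW ij)) expgnDr.
  by rewrite subnKC 1?ltnW// => /mulgI ->.
have : (`I_N.+1 #<= `I_N)%card.
  apply: card_le_trans HN; pose f (i : nat) := [set x ^+ i * h | h in H].
  have fI : {in `I_N.+1 &, injective f}.
    move=> i j; rewrite !inE /= => iN jN fij.
    by case: (ltngtP i j) => // [ij|ji]; exfalso;
      [apply: (xH i j) | apply: (xH j i)] => //; apply/andP.
  rewrite -(card_le_eql (inj_card_eq fI)); apply: subset_card_le.
  by move=> _ [i _ <-]; exists (x ^+ i).
by rewrite card_le_II ltnn.
Qed.

End NormalSubgroups.

(* The root of the balanced tree of commutators with leaves [x ^+ j],
   s < j <= s + 2 ^ k.  Each level turns a length bound l into 4 l + 4 L, the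
   conjugation by [g] included, hence multiplies l + 2 L by at most 4. *)
Lemma common_multiple_word (G K : groupType) (X : set G)
    (phi : UMagmaMorphism.type G K) (P : K -> Prop) (x : G) (L M : nat) :
  word_le X L x ->
  (forall j, (0 < j <= M)%N -> P (phi x ^+ j)) ->
  (forall u v, P u -> P v -> exists2 g, word_le X L g & P [~ u, v ^ phi g]) ->
  forall k s, (s + 2 ^ k <= M)%N -> exists l w,
  [/\ (l + L.*2 <= 4 ^ k * (M * L + L.*2))%N, word_le X l w, P (phi w)
    & forall H, normal_subgroup H ->
        (exists2 j, (s < j <= s + 2 ^ k)%N & H (x ^+ j)) -> H w].
Proof.
move=> xL Px PR; elim=> [|k IH] s sM.
  exists (M * L)%N, (x ^+ s.+1); rewrite addn1 in sM *; split.
  - by rewrite mul1n.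
  - by apply: word_le_leq (word_leX s.+1 xL); rewrite leq_mul2r sM orbT.
  - by rewrite gmulfXn; apply: Px.
  - by move=> H nH [j]; rewrite -eqn_leq => /eqP ->.
have sM1 : (s + 2 ^ k <= M)%N by move: sM; rewrite expnS; lia.
have sM2 : (s + 2 ^ k + 2 ^ k <= M)%N by move: sM; rewrite expnS; lia.
have [l1 [w1 [l1L w1l Pw1 w1H]]] := IH _ sM1.
have [l2 [w2 [l2L w2l Pw2 w2H]]] := IH _ sM2.
have [g gL Pg] := PR _ _ Pw1 Pw2.
exists (l1 + (l2 + L.*2)).*2, [~ w1, w2 ^ g]; split.
- by rewrite expnS -mulnA; lia.
- by apply: word_leR => //; apply: word_leJ.
- by rewrite gmulfR gmulfJ.
move=> H nH [j /andP[sj jM] Hj].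
have [jk|jk] := leqP j (s + 2 ^ k).
  by apply: normal_subgroupRl => //; apply: w1H => //; exists j; rewrite ?sj.
apply: normal_subgroupRr => //; apply: normal_subgroupJ => //.
apply: w2H => //; exists j => //.
by rewrite jk -addnA addnn -mul2n -expnS.
Qed.

Lemma free_basis_noncommuting (G : groupType) (m : nat) (e : 'I_m -> G) :
  free_basis e -> nonabelian G -> exists i j, e i * e j <> e j * e i.
Proof.
move=> fe nabG; apply: contrapT => ncom; apply: nabG.
have com i j : commute (e i) (e j).
  by apply: contrapT => ecij; apply: ncom; exists i, j.
have centr x : (forall i, commute x (e i)) -> forall g, commute x g.
  move=> xe g.
  pose cx (g : G) := g ^ x.
  have cxM : {morph cx : u v / u * v} by move=> u v; rewrite /cx conjMg.
  pose phi : {multiplicative G -> G} :=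
    HB.pack cx (isMultiplicative.Build G G cx cxM).
  have [_ uniq] := fe G e.
  have idM : {morph (@idfun G) : u v / u * v} by [].
  pose psi : {multiplicative G -> G} :=
    HB.pack (@idfun G) (isMultiplicative.Build G G idfun idM).
  apply/commute_sym/commgP/conjg_fixP; apply: (uniq phi psi) => // i.
  by apply/conjg_fixP/commgP/commute_sym.
by move=> x y; apply: (centr) => i; apply/commute_sym/centr.
Qed.

Lemma exists_high_order_elt (M : nat) :
  exists (F : finFieldType) (t : F), [/\ 2 \in [pchar F]%R, (t != 0)%R
    & forall j, (0 < j <= M)%N -> (t ^+ j != 1)%R].
Proof.
have [F charF cardF] := @pPrimePowerField 2 M.+2 isT isT.
have /cyclicP[u Fu] := field_unit_group_cyclic [set: {unit F}]%G.
exists F, (val u); split=> //; first by rewrite -unitfE; exact: valP.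
move=> j /andP[j_gt0 jM]; apply/negP => /eqP uj.
have /eqP : u ^+ j = 1 by apply: val_inj; rewrite FinRing.val_unitX.
rewrite -order_dvdn => /dvdn_leq => /(_ j_gt0).
rewrite orderE -Fu card_finField_unit cardF leqNgt => /negP; apply.
apply: leq_ltn_trans jM _; rewrite -ltnS prednK ?expn_gt0//.
exact: ltnW (ltn_expl M.+2 (isT : 1 < 2)%N).
Qed.

Local Close Scope group_scope.

Lemma sqr_eq1_pchar2 (R : idomainType) (c : R) :
  2 \in [pchar R] -> c ^+ 2 = 1 -> c = 1.
Proof.
move=> c2 cc; apply/eqP; rewrite -subr_eq0 -sqrf_eq0 sqrrB1 cc.
by rewrite -mulr_natl (pcharf0 c2) mul0r subr0 -[1 + 1]/(2%:R) (pcharf0 c2).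
Qed.

Lemma ord2_cases (i : 'I_2) : i = 0 \/ i = 1.
Proof. by case: i => -[|[|//]] ?; [left|right]; apply: val_inj. Qed.

Section GL2.
Variable F : finFieldType.
Implicit Types u v w : {'GL_2[F]}.

Definition central u : bool := [&& u 0 0 == u 1 1, u 0 1 == 0 & u 1 0 == 0].

Lemma centralE u : central u -> GLval u = (u 0 0)%:M.
Proof.
move=> /and3P[/eqP u11 /eqP u01 /eqP u10].
apply/matrixP => i j; rewrite !mxE.
by case: (ord2_cases i) (ord2_cases j) => -> [] ->.
Qed.

Lemma mulGL_entry u v i j : GLval (u * v)%g i j = u i 0 * v 0 j + u i 1 * v 1 j.
Proof.
rewrite GL_MxE mxE big_ord_recl big_ord1.
by congr (_ * _ + _ * _); congr (GLval _ _ _); apply: val_inj.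
Qed.

(* Equality of the determinants of [u v] and [v u] forces the square of a scalar
   commutator to be 1. *)
Lemma commute_of_central_commg u v :
  2 \in [pchar F] -> central [~ u, v]%g -> commute u v.
Proof.
move=> c2; have := commgC u v; move: [~ u, v]%g => r E /centralE.
set c := _ 0 0 => uvc.
suff c1 : c = 1.
  apply: val_inj; rewrite -[LHS]/(GLval _) -[RHS]/(GLval _) E.
  by rewrite [LHS]GL_MxE uvc c1 mulmx1.
apply: sqr_eq1_pchar2 c2 _.
have := congr1 (fun w : {'GL_2[F]} => \det (GLval w)) E.
rewrite !GL_MxE uvc !det_mulmx det_scalar.
have := GL_det u; have := GL_det v => v0 u0.
rewrite [\det u * _]mulrC => H.
have uv0 : \det v * \det u != 0 by rewrite mulf_neq0.
by apply: (mulfI uv0); rewrite mulr1 -H.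
Qed.

Lemma commute_noncentral u v : ~~ central u -> commute u v ->
  exists l, [/\ v 0 1 = l * u 0 1, v 1 0 = l * u 1 0
    & v 0 0 - v 1 1 = l * (u 0 0 - u 1 1)].
Proof.
move=> cu uv; have E i j : GLval (u * v)%g i j = GLval (v * u)%g i j by rewrite uv.
have := E 0 0; have := E 0 1; have := E 1 0; rewrite !mulGL_entry.
move=> E10 E01 E00.
have bc : v 0 1 * u 1 0 = v 1 0 * u 0 1.
  by apply: subr0_eq; move/eqP: E00; rewrite eq_sym -subr_eq0 => /eqP <-; ring.
have pb : (v 0 0 - v 1 1) * u 0 1 = v 0 1 * (u 0 0 - u 1 1).
  by apply: subr0_eq; move/eqP: E01; rewrite eq_sym -subr_eq0 => /eqP <-; ring.
have pc : (v 0 0 - v 1 1) * u 1 0 = v 1 0 * (u 0 0 - u 1 1).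
  by apply: subr0_eq; move/eqP: E10; rewrite -subr_eq0 => /eqP <-; ring.
move: cu; rewrite /central !negb_and -subr_eq0 => /or3P[] k0.
- exists ((v 0 0 - v 1 1) / (u 0 0 - u 1 1)).
  by rewrite ![_ / _ * _]mulrAC pb pc !mulfK.
- by exists (v 0 1 / u 0 1); rewrite ![_ / _ * _]mulrAC -pb bc !mulfK.
- by exists (v 1 0 / u 1 0); rewrite ![_ / _ * _]mulrAC -pc -bc !mulfK.
Qed.

Lemma GL2_entries (a b c d : F) : a * d - b * c != 0 ->
  exists u, [/\ u 0 0 = a, u 0 1 = b, u 1 0 = c & u 1 1 = d].
Proof.
move=> det0.
pose A := \matrix_(i < 2, j < 2)
  if i == 0 then if j == 0 then a else b else if j == 0 then c else d.
have uA : A \in unitmx.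
  by rewrite unitmxE unitfE (expand_det_row _ 0) big_ord_recl big_ord1 /cofactor
    !det_mx11 !mxE /= expr0 expr1 mul1r mulN1r mulrN.
by exists (FinRing.unit _ (uA : (A : 'M[F]_2) \is a GRing.unit)); rewrite /= !mxE.
Qed.

Lemma diag_expg (t : F) u n :
  [/\ u 0 0 = t, u 0 1 = 0, u 1 0 = 0 & u 1 1 = 1] ->
  [/\ GLval (u ^+ n)%g 0 0 = t ^+ n, GLval (u ^+ n)%g 0 1 = 0,
      GLval (u ^+ n)%g 1 0 = 0 & GLval (u ^+ n)%g 1 1 = 1].
Proof.
move=> [u00 u01 u10 u11]; elim: n => [|n [v00 v01 v10 v11]].
  by rewrite expg0 GL_1E !mxE.
rewrite expgS !mulGL_entry u00 u01 u10 u11 v00 v01 v10 v11 exprS.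
by split; ring.
Qed.

Lemma commute_noncentral_trans u v w : ~~ central u -> ~~ central v ->
  commute u v -> commute u w ->
  exists l, [/\ w 0 1 = l * v 0 1, w 1 0 = l * v 1 0
    & w 0 0 - w 1 1 = l * (v 0 0 - v 1 1)].
Proof.
move=> cu cv /(commute_noncentral cu)[l [v01 v10 v0011]].
move=> /(commute_noncentral cu)[m [-> -> ->]].
have l0 : l != 0.
  apply: contraNneq cv => l0; move: v01 v10 v0011.
  by rewrite l0 !mul0r /central -subr_eq0 => -> -> ->; rewrite eqxx.
by exists (m / l); rewrite v01 v10 v0011 !mulrA !divfK.
Qed.

(* If the conclusion fails, conjugation by [x] and by [y] preserves the line that
   [v] spans modulo scalar matrices.  For [x] = diag(t, 1) and t ^+ 2 != 1 this
   line is one of the three coordinate axes, and [y] preserves none of these. *)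
Lemma noncommuting_conj (t : F) (x y u v : {'GL_2[F]}) :
  2 \in [pchar F] -> t != 0 -> t != 1 ->
  [/\ x 0 0 = t, x 0 1 = 0, x 1 0 = 0 & x 1 1 = 1] ->
  [/\ y 0 0 = 1, y 0 1 = 1, y 1 0 = 1 & y 1 1 = t] ->
  ~~ central u -> ~~ central v ->
  [\/ ~ commute u v, ~ commute u (v ^ x)%g | ~ commute u (v ^ y)%g].
Proof.
move=> c2 t0 t1 [x00 x01 x10 x11] [y00 y01 y10 y11] cu cv.
have [uv|] := pselect (commute u v); last by constructor 1.
have [uw|] := pselect (commute u (v ^ x)%g); last by constructor 2.
have [uz|] := pselect (commute u (v ^ y)%g); last by constructor 3.
exfalso.
have xw : (x * v ^ x)%g = (v * x)%g by rewrite -conjgC.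
have yz : (y * v ^ y)%g = (v * y)%g by rewrite -conjgC.
have [w wE] : exists w : {'GL_2[F]}, w = (v ^ x)%g by exists (v ^ x)%g.
have [z zE] : exists z : {'GL_2[F]}, z = (v ^ y)%g by exists (v ^ y)%g.
move: uw uz xw yz; rewrite -{}wE -{}zE => uw uz xw yz.
have Ex i j : GLval (x * w)%g i j = GLval (v * x)%g i j by rewrite xw.
have Ey i j : GLval (y * z)%g i j = GLval (v * y)%g i j by rewrite yz.
have := Ex 0 0; have := Ex 0 1; have := Ex 1 0; have := Ex 1 1.
have := Ey 0 0; have := Ey 0 1; have := Ey 1 0; have := Ey 1 1.
rewrite !mulGL_entry x00 x01 x10 x11 y00 y01 y10 y11.
rewrite !(mul0r, mulr0, add0r, addr0, mul1r, mulr1) => y4 y3 y2 y1 x4 x3 x2 x1.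
have [m [w01 w10 w0011]] := commute_noncentral_trans cu cv uv uw.
have [n [z01 z10 z0011]] := commute_noncentral_trans cu cv uv uz.
have w00 : w 0 0 = v 0 0 by apply: (mulfI t0); rewrite x1 mulrC.
rewrite {}w10 in x3; rewrite {}w01 in x2; rewrite w00 x4 in w0011.
have [p0|p0] := eqVneq (v 0 0 - v 1 1) 0; last first.
  have m1 : m = 1 by apply: (mulIf p0); rewrite mul1r.
  have tI a : a = t * a -> a = 0.
    move=> /eqP; rewrite -subr_eq0 -{1}[a]mul1r -mulrBl mulf_eq0 subr_eq0.
    by rewrite eq_sym (negbTE t1) => /eqP.
  have v01 : v 0 1 = 0 by apply: tI; rewrite -[LHS]x2 m1 mul1r.
  have v10 : v 1 0 = 0 by apply: tI; rewrite mulrC -x3 m1 mul1r.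
  move: y1 y3; rewrite z10 v10 v01 !mulr0 !addr0 add0r => -> v00.
  by rewrite v00 subrr eqxx in p0.
have v00 := subr0_eq p0.
have z00 : z 0 0 = z 1 1 by apply: subr0_eq; rewrite z0011 p0 mulr0.
have [v01|v01] := eqVneq (v 0 1) 0.
  move: y2 y4; rewrite z01 v01 mulr0 mul0r !add0r addr0 v00 [t * _]mulrC => ->.
  move=> /esym/eqP; rewrite -subr_eq0 addrK => v10.
  by rewrite /central v01 v10 v00 !eqxx in cv.
have [v10|v10] := eqVneq (v 1 0) 0.
  move: y1 y3; rewrite z10 v10 !mulr0 !addr0 add0r => -> /eqP.
  by rewrite v00 -subr_eq0 addrAC subrr add0r (negbTE v01).
have tm : t * m = 1 by apply: (mulIf v01); rewrite mul1r -mulrA.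
have mt : m = t by apply: (mulIf v10); rewrite x3 mulrC.
by move: t1; rewrite (@sqr_eq1_pchar2 _ t) ?eqxx// expr2 -{2}mt.
Qed.
End GL2.

Lemma cube_root_le (R : realType) (n k : nat) :
  (n <= 8 ^ k)%N -> n%:R `^ 3%:R^-1 <= (2 ^ k)%:R :> R.
Proof.
move=> nk; apply: le_trans (_ : (8 ^ k)%:R `^ 3%:R^-1 <= _).
  by apply: ge0_ler_powR; rewrite ?nnegrE ?ler_nat ?invr_ge0.
have -> : (8 ^ k)%:R = (2 ^ k)%:R `^ 3%:R :> R.
  by rewrite powR_mulrn// -natrX -expnM mulnC expnM.
by rewrite -powRrM mulfV ?pnatr_eq0// powRr1.
Qed.

Lemma free_group_common_multiple (G : groupType) (m : nat) (X : set G) :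
  free_of_rank G m -> nonabelian G -> generates X ->
  exists L : nat, forall k, exists w : G, [/\ w <> 1%g, word_le X (L * 8 ^ k) w
    & forall H, normal_subgroup H -> index_le H (2 ^ k) -> H w].
Proof.
move=> [e fe] nabG genX.
have [i [j eij]] := free_basis_noncommuting fe nabG.
have ij : i != j by apply: contra_notN eij => /eqP ->.
have [La eiL] := generates_word (e i) genX.
have [Lb ejL] := generates_word (e j) genX.
pose L := maxn La Lb; exists (3 * L)%N => k.
have [F [t [c2 t0 t1]]] := exists_high_order_elt (2 ^ k).
have tn1 : t != 1 by rewrite -[t]expr1 t1 ?expn_gt0.
have [|x xE] := @GL2_entries F t 0 0 1; first by rewrite mulr1 mulr0 subr0.
have [|y yE] := @GL2_entries F 1 1 1 t; first by rewrite mul1r mulr1 subr_eq0.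
have [[phi0 phi0E] _] := fe {'GL_2[F]} (fun l => if l == i then x else y).
have phi1 : phi0 1%g = 1%g.
  by apply: (mulgI (phi0 1%g)); rewrite -gmulfM !mulg1.
pose phi : UMagmaMorphism.type G {'GL_2[F]} :=
  HB.pack (Multiplicative.sort phi0)
    (Multiplicative_isUMagmaMorphism.Build G {'GL_2[F]} phi0 phi1).
have phix : phi (e i) = x by rewrite [LHS]phi0E eqxx.
have phiy : phi (e j) = y by rewrite [LHS]phi0E eq_sym (negbTE ij).
pose P (u : {'GL_2[F]}) : Prop := ~~ central u.
have Px n : (0 < n <= 2 ^ k)%N -> P (phi (e i) ^+ n)%g.
  move=> /t1 tn; rewrite phix /P /central.
  by have [-> _ _ ->] := diag_expg n xE; rewrite (negbTE tn).
have PR (u v : {'GL_2[F]}) : P u -> P v ->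
    exists2 g, word_le X L g & P [~ u, v ^ phi g]%g.
  move=> Pu Pv; have Pc (w : {'GL_2[F]}) : ~ commute u w -> P [~ u, w]%g.
    by apply: contra_notN => /(commute_of_central_commg c2).
  have [] := noncommuting_conj c2 t0 tn1 xE yE Pu Pv => /Pc uv.
  - by exists 1%g; [exact: word_le1 | rewrite gmulf1 conjg1].
  - exists (e i); last by rewrite phix.
    by apply: word_le_leq eiL; rewrite leq_maxl.
  - exists (e j); last by rewrite phiy.
    by apply: word_le_leq ejL; rewrite leq_maxr.
have [|l [w [lL wl Pw wH]]] :=
    common_multiple_word _ Px PR (leqnn (0 + 2 ^ k)%N).
  by apply: word_le_leq eiL; rewrite leq_maxl.
exists w; split.
- by move=> w1; move: Pw; rewrite w1 gmulf1 /P /central GL_1E !mxE /= !eqxx.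
- have -> : (8 ^ k = 4 ^ k * 2 ^ k)%N by rewrite -expnMn.
  apply: (word_le_leq _ wl).
  apply: leq_trans (leq_trans (leq_addr _ _) lL) _.
  rewrite mulnCA leq_mul2l; apply/orP; right.
  have : (0 < 2 ^ k)%N by rewrite expn_gt0.
  nia.
- move=> H nH HN; apply: wH => //.
  by have := index_le_expg nH (e i) HN; rewrite add0n.
Qed.

Theorem proposition4p3 (R : realType) (G : groupType) (m : nat) (X : set G) :
  free_of_rank G m -> nonabelian G -> finite_set X -> generates X ->
  asymp_le (fun n : nat => (n%:R `^ (3%:R^-1))%:E : \bar R) (rf_growth R X).
Proof.
move=> freeG nabG _ genX.
have [L Lw] := free_group_common_multiple freeG nabG genX.
exists (2 + L)%N => // n n_gt0.
have /andP[kn nk] := trunc_log_bounds (isT : (1 < 8)%N) n_gt0.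
move: (trunc_log 8 n) kn nk => k kn nk.
have [w [w1 wL wH]] := Lw k.
have rf_gt : ((2 ^ k)%:R%:E < rf_growth R X ((2 + L) * n))%E.
  rewrite ltNge; apply/negP; rewrite /rf_growth least_le => -[N [N_gt0 HN] Nk].
  have [|H [nH HN' Hw]] := HN w w1.
    apply/word_length_le; apply: word_le_leq wL.
    by apply: leq_mul; rewrite ?leq_addl.
  apply: Hw; apply: (wH _ nH); apply: (card_le_trans HN').
  by rewrite card_le_II.
apply: (@le_trans _ _ (2%:R%:E * (2 ^ k)%:R%:E)%E).
  by rewrite -EFinM lee_fin -natrM -expnS cube_root_le// ltnW.
apply: lee_pmul; rewrite ?lee_fin ?ler_nat ?ler0n ?leq_addr//.
exact: ltW.
Qed.
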